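(* Let $a_0, a_1, a_2 \in \mathbb{R}$, let $\tau_1, \tau_2 \in (0,+\infty)$ with $0 < \tau_1 < \tau_2$, and let $s_0 \in \mathbb{R}$. Consider the delay-differential equation $$y'(t) + a_0 y(t) + a_1 y(t-\tau_1) + a_2 y(t-\tau_2) = 0$$ and its characteristic function $\Delta : \mathbb{C} \to \mathbb{C}$, $\Delta(s) = s + a_0 + a_1 e^{-s\tau_1} + a_2 e^{-s\tau_2}$. If $s_0$ is a root of $\Delta$ of (maximal) multiplicity $3$, then $s_0$ is a strictly dominant root of $\Delta$. In particular, if $s_0 < 0$, then the delay-differential equation is exponentially stable.
   Context: A real root $s_0$ of a function $\Delta : \mathbb{C} \to \mathbb{C}$ is called strictly dominant if every $s \in \mathbb{C}$ with $\Delta(s) = 0$ satisfies $s = s_0$ or $\operatorname{Re} s < s_0$. The multiplicity of any root of $\Delta(s) = s + a_0 + a_1 e^{-s\tau_1} + a_2 e^{-s\tau_2}$ is at most $3$, hence multiplicity $3$ is called maximal. The delay-differential equation is exponentially stable if there exist $C, \gamma > 0$ such that every solution $y$ with continuous initial condition $\varphi : [-\tau_2, 0] \to \mathbb{R}$ satisfies $|y(t)| \le C e^{-\gamma t} \sup_{[-\tau_2,0]} |\varphi|$ for all $t \ge 0$; it is a classical fact that this holds if and only if all roots of $\Delta$ have negative real part. *)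

(* Defs.v *)
(* Stdlib reals with Coquelicot. *)
From Stdlib Require Import Reals.
From Coquelicot Require Import Coquelicot.
Open Scope R_scope.

(* Coquelicot has no complex exponential: e^(x + iy) = e^x (cos y + i sin y). *)
Definition Cexp (z : C) : C :=
  (exp (Re z) * cos (Im z), exp (Re z) * sin (Im z)).

Definition char_fun (a0 a1 a2 tau1 tau2 : R) (s : C) : C :=
  (s + RtoC a0 + RtoC a1 * Cexp (- (s * RtoC tau1))
     + RtoC a2 * Cexp (- (s * RtoC tau2)))%C.

(* For an entire function f; D k is the k-th complex derivative of f. *)
Definition root_of_multiplicity (m : nat) (f : C -> C) (z0 : C) : Prop :=
  exists D : nat -> C -> C,
    (forall z : C, D 0%nat z = f z) /\
    (forall (k : nat) (z : C),
       is_derive (K := C_AbsRing) (V := C_NormedModule) (D k) z (D (S k) z)) /\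
    (forall k : nat, (k < m)%nat -> D k z0 = RtoC 0) /\
    D m z0 <> RtoC 0.

Definition strictly_dominant_root (f : C -> C) (s0 : R) : Prop :=
  f (RtoC s0) = RtoC 0 /\
  forall s : C, f s = RtoC 0 -> s = RtoC s0 \/ Re s < s0.

(* Values of phi outside [-tau2, 0], and of y on (-oo, -tau2), are irrelevant.
   The equation is required for t > 0; with the continuity of y it then also
   holds at t = 0 for the right derivative. *)
Definition dde_solution (a0 a1 a2 tau1 tau2 : R) (phi y : R -> R) : Prop :=
  continuous_on (fun t : R => - tau2 <= t) y /\
  (forall t : R, - tau2 <= t <= 0 -> y t = phi t) /\
  (forall t : R, 0 < t ->
     ex_derive y t /\
     Derive y t + a0 * y t + a1 * y (t - tau1) + a2 * y (t - tau2) = 0).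

Definition sup_abs (a b : R) (phi : R -> R) : R :=
  real (Lub_Rbar (fun r : R => exists t : R, a <= t <= b /\ r = Rabs (phi t))).

Definition exponentially_stable (a0 a1 a2 tau1 tau2 : R) : Prop :=
  exists K gamma : R, 0 < K /\ 0 < gamma /\
    forall phi y : R -> R,
      continuous_on (fun t : R => - tau2 <= t <= 0) phi ->
      dde_solution a0 a1 a2 tau1 tau2 phi y ->
      forall t : R, 0 <= t ->
        Rabs (y t) <= K * exp (- gamma * t) * sup_abs (- tau2) 0 phi.

(* Main.v *)
(* A triple root at [s0] determines the coefficients: with [a = tau1], [b = tau2],
   the function [x(t) = e^(-s0 t) y(t)] solves
     [a b (b - a) x' = (b^2 - a^2) x - b^2 x(t - a) + a^2 x(t - b)],
   for which [1], [t], [t^2] are solutions. Comparing the squares of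
   [(b^2 - a^2) x - a b (b - a) x'] and [b^2 x(t - a) - a^2 x(t - b)] produces a
   quadratic functional that decreases along solutions, by Cauchy-Schwarz applied
   to [x(t - a) - x(t - b)]. Once a multiple of [t^2] is subtracted so that the
   first integral [drift] vanishes, the functional is invariant under adding
   constants to [x]; centring [x] at [x(t - a)], it becomes a sum of
   [int_{t-a}^t ((a + b) (x - x(t - a)) - a b x')^2] and of a term that is
   nonnegative by a Hardy inequality, and so controls [x(t) - x(t - a)]. Hence
   [y(t) = O((1 + t)^2 e^(s0 t))] for every solution [y], uniformly in the initial
   datum. This gives exponential stability when [s0 < 0] and, applied to
   [Re e^(s t)] and [Im e^(s t)], the bound [Re s <= s0] for every root [s]. On the
   line [Re s = s0], taking moduli in the characteristic equation gives
   [2 (1 - cos theta) = theta^2] with [theta = (b - a) Im s], so [theta = 0]. *)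
Require Import Defs.
From Stdlib Require Import Reals Lra Psatz.
From Coquelicot Require Import Coquelicot.
Open Scope R_scope.

(** * Monotonicity from derivatives, and primitives *)

Lemma is_derive_continuity_pt (f : R -> R) (t l : R) :
  is_derive f t l -> continuity_pt f t.
Proof.
  intros h; apply derivable_continuous_pt; exists l; now apply is_derive_Reals.
Qed.

(** Mean value theorem with differentiability only inside the interval: a solution of the delay
    equation is differentiable for [t > 0] but merely continuous at [0], where the energy estimate
    starts. *)
Lemma derive_nonneg_le_open (f df : R -> R) (u v : R) :
  u <= v ->
  (forall t, u < t < v -> is_derive f t (df t)) ->
  (forall t, u <= t <= v -> continuity_pt f t) ->
  (forall t, u < t < v -> 0 <= df t) ->
  f u <= f v.
Proof.
  intros [huv | ->] hd hc hp; [| lra].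
  assert (pr : forall c, u < c < v -> derivable_pt f c)
    by (intros c hcc; exists (df c); apply is_derive_Reals, hd, hcc).
  destruct (MVT f id u v pr (fun c _ => derivable_pt_id c) huv hc) as [c [hcc e]].
  { intros c _; apply derivable_continuous_pt, derivable_pt_id. }
  assert (hcd : derive_pt f c (pr c hcc) = df c).
  { apply derive_pt_eq, is_derive_Reals, hd, hcc. }
  rewrite hcd, derive_pt_id in e; unfold id in e.
  specialize (hp c hcc); nra.
Qed.

Lemma derive_nonneg_le (f df : R -> R) (u v : R) :
  u <= v ->
  (forall t, u <= t <= v -> is_derive f t (df t)) ->
  (forall t, u <= t <= v -> 0 <= df t) ->
  f u <= f v.
Proof.
  intros huv hd hp; apply (derive_nonneg_le_open f df); auto.
  - intros t ht; apply hd; lra.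
  - intros t ht; exact (is_derive_continuity_pt f t _ (hd t ht)).
  - intros t ht; apply hp; lra.
Qed.

Lemma derive_zero_eq (f : R -> R) (u v : R) :
  u <= v ->
  (forall t, u <= t <= v -> is_derive f t 0) ->
  f u = f v.
Proof.
  intros huv hd; apply Rle_antisym.
  - apply (derive_nonneg_le f (fun _ => 0)); auto; intros; lra.
  - enough (- f u <= - f v) by lra.
    apply (derive_nonneg_le (fun t => - f t) (fun _ => - 0)); auto; intros; try lra.
    apply (is_derive_opp f); auto.
Qed.

Lemma primitive_exists (f : R -> R) (c : R) :
  (forall t, c < t -> continuous f t) ->
  exists F : R -> R, forall t, c < t -> is_derive F t (f t).
Proof.
  (* Continuity is known only to the right of [c], so the integral starts at the interior point
     [c + 1]. *)
  intros hf; exists (fun t => RInt f (c + 1) t); intros t ht.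
  apply (is_derive_RInt f _ (c + 1)); [| now apply hf].
  apply (filter_imp (fun u => c < u)); [| now apply open_gt].
  intros u hu; apply (RInt_correct (V := R_CompleteNormedModule)), (ex_RInt_continuous (V := R_CompleteNormedModule)).
  intros z hz; apply hf; revert hz; unfold Rmin; destruct Rle_dec; lra.
Qed.

(** On function variables [auto_derive] leaves [ex_derive] side conditions and unevaluated [Derive]
    terms. This tactic and the next settle them from [is_derive] hypotheses in the context, the
    range of times being checked by [lra]. *)
Ltac known_ex_derive :=
  repeat split;
  try match goal with
  | |- ex_derive (fun u => ?X u) ?s =>
    match goal with
    | h : forall t, _ -> is_derive X t _ |- _ => exact (ex_intro _ _ (h s ltac:(lra)))
    end
  end.

Ltac known_derive :=
  repeat match goal with
  | |- context [Derive (fun u => ?X u) ?s] =>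
    match goal with
    | h : forall t, _ -> is_derive X t _ |- _ =>
      match type of (h s) with
      | _ -> is_derive _ _ ?l =>
        replace (Derive (fun u => X u) s) with l
          by (symmetry; apply is_derive_unique, h; lra)
      end
    end
  end.

(** * The quadratic functional of the normalized equation *)

(* [X2], [G], [H] stand for primitives of [x^2], [x'^2] and [G]; the last term is
   the integral over [u] in [t - b, t] of [min (b - a) (u - t + b) x'(u)^2], up to
   the factor [a^2 b^2 (b - a)]. *)
Definition gap_energy (a b : R) (x X2 G H : R -> R) (t : R) : R :=
  (b^2 - a^2) * b^2 * (X2 t - X2 (t - a)) - (b^2 - a^2) * a^2 * (X2 t - X2 (t - b))
  - (b^2 - a^2) * (a * b * (b - a)) * (x t)^2
  + a^2 * b^2 * (b - a) * ((b - a) * G t - H (t - a) + H (t - b)).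

Lemma gap_energy_derive (a b : R) (x dx X2 G H : R -> R) t :
  0 < a < b ->
  (forall t, 0 < t -> is_derive x t (dx t)) ->
  (forall t, 0 < t -> is_derive X2 t ((x t)^2)) ->
  (forall t, 0 < t -> is_derive G t ((dx t)^2)) ->
  (forall t, 0 < t -> is_derive H t (G t)) ->
  b < t -> 
    a * b * (b - a) * dx t = (b^2 - a^2) * x t - b^2 * x (t - a) + a^2 * x (t - b) ->
  is_derive (gap_energy a b x X2 G H) t
    (- a^2 * b^2 * ((b - a) * (G (t - a) - G (t - b)) - (x (t - a) - x (t - b))^2)).
Proof.
  intros hab hx hX2 hG hH ht heq; unfold gap_energy.
  auto_derive.
  { known_ex_derive. }
  known_derive.
  (* The derivative minus its claimed value is exactly this difference of squares, which the
     equation makes zero. *)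
  assert (E : ((b^2 - a^2) * x t - a * b * (b - a) * dx t)^2
     - (b^2 * x (t - a) - a^2 * x (t - b))^2 = 0) by (rewrite heq; ring).
  apply Rminus_diag_uniq; rewrite <- E.
  unfold Rminus; ring.
Qed.

(** Cauchy-Schwarz without integrals: with [c] the mean slope of [x], a primitive of [(x' - c)^2] is
    nondecreasing. *)
Lemma sq_increment_le (x dx G : R -> R) (u v : R) :
  u < v ->
  (forall t, u <= t <= v -> is_derive x t (dx t)) ->
  (forall t, u <= t <= v -> is_derive G t ((dx t)^2)) ->
  (x v - x u)^2 <= (v - u) * (G v - G u).
Proof.
  intros huv hx hG.
  set (c := (x v - x u) / (v - u)).
  assert (h : G u - 2 * c * x u + c^2 * u <= G v - 2 * c * x v + c^2 * v).
  { apply (derive_nonneg_le (fun t => G t - 2 * c * x t + c^2 * t)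
             (fun t => (dx t - c)^2)); [lra | | intros; apply pow2_ge_0].
    intros t ht; auto_derive.
    - known_ex_derive.
    - known_derive; ring. }
  assert (hc : c * (v - u) = x v - x u) by (unfold c; field; lra).
  nra.
Qed.

Lemma gap_energy_mono (a b : R) (x dx X2 G H : R -> R) (t0 t1 : R) :
  0 < a < b ->
  (forall t, 0 < t -> is_derive x t (dx t)) ->
  (forall t, b < t ->
    a * b * (b - a) * dx t = (b^2 - a^2) * x t - b^2 * x (t - a) + a^2 * x (t - b)) ->
  (forall t, 0 < t -> is_derive X2 t ((x t)^2)) ->
  (forall t, 0 < t -> is_derive G t ((dx t)^2)) ->
  (forall t, 0 < t -> is_derive H t (G t)) ->
  b < t0 <= t1 ->
  gap_energy a b x X2 G H t1 <= gap_energy a b x X2 G H t0.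
Proof.
  intros hab hx heq hX2 hG hH ht.
  enough (- gap_energy a b x X2 G H t0 <= - gap_energy a b x X2 G H t1) by lra.
  apply (derive_nonneg_le (fun t => - gap_energy a b x X2 G H t)
    (fun t => - (- a^2 * b^2 * ((b - a) * (G (t - a) - G (t - b)) - (x (t - a) - x (t - b))^2))));
    [lra | |]; intros t htt.
  - apply (is_derive_opp (gap_energy a b x X2 G H)).
    apply (gap_energy_derive a b x dx); auto; try lra; apply heq; lra.
  - assert (h : (x (t - a) - x (t - b))^2 <= (t - a - (t - b)) * (G (t - a) - G (t - b))).
    { apply (sq_increment_le x dx); [lra | |]; intros; [apply hx | apply hG]; lra. }
    assert (0 <= a^2 * b^2) by nra.
    replace (t - a - (t - b)) with (b - a) in h by ring.
    nra.
Qed.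

(** With [w = x - e] and [k = (a + b) / (a b)], the right side is [a^2 b^2] times the integral of
    [(w' - k w)^2] over [[t - a, t]]. Since [w] vanishes at [t - a], [E t * w t] is the integral of
    [E (w' - k w)], where [E] is the integrating factor; Cauchy-Schwarz and [E <= 1] give the
    bound. *)
Lemma exp_weighted_bound (a b e t : R) (x dx X X2 G : R -> R) :
  0 < a < b -> a < t -> e = x (t - a) ->
  (forall t, 0 < t -> is_derive x t (dx t)) ->
  (forall t, 0 < t -> is_derive X t (x t)) ->
  (forall t, 0 < t -> is_derive X2 t ((x t)^2)) ->
  (forall t, 0 < t -> is_derive G t ((dx t)^2)) ->
  a * b^2 * (exp (- ((a + b) / b)))^2 * (x t - e)^2 <=
  (a + b)^2 * (X2 t - X2 (t - a) - 2 * e * (X t - X (t - a)) + e^2 * a)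
  + a^2 * b^2 * (G t - G (t - a)) - (a + b) * a * b * (x t - e)^2.
Proof.
  intros hab ht he hx hX hX2 hG.
  set (k := (a + b) / (a * b)).
  set (E := fun u => exp (- k * (u - (t - a)))).
  assert (hEt : E t = exp (- ((a + b) / b))).
  { unfold E, k; f_equal; field; lra. }
  rewrite <- hEt.
  (* The mean of [E (w' - k w)]. With [q = w' - k w], Cauchy-Schwarz becomes the pointwise
     inequality [q^2 - 2 c E q + c^2 = (q - c E)^2 + c^2 (1 - E^2) >= 0]. *)
  set (c := E t * (x t - e) / a).
  set (P := fun u => (a + b)^2 * (X2 u - 2 * e * X u + e^2 * u) + a^2 * b^2 * G u
     - (a + b) * a * b * (x u - e)^2
     - a^2 * b^2 * (2 * c * (E u * (x u - e)) - c^2 * u)).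
  assert (hk : a * b * k = a + b) by (unfold k; field; lra).
  assert (hk0 : 0 < k) by (unfold k; apply Rdiv_lt_0_compat; nra).
  assert (h : P (t - a) <= P t).
  { apply (derive_nonneg_le P (fun u =>
      a^2 * b^2 * ((dx u - k * (x u - e))^2
         - 2 * c * E u * (dx u - k * (x u - e)) + c^2))); [lra | |]; intros u hu.
    - unfold P, E; auto_derive.
      + known_ex_derive.
      + known_derive.
        rewrite <- hk; ring_simplify. unfold Rminus; ring.
    - assert (hE : 0 < E u <= 1).
      { split; [apply exp_pos |]. rewrite <- exp_0; unfold E.
        destruct (Req_dec u (t - a)) as [-> | hne].
        - right; f_equal; ring.
        - left; apply exp_increasing; nra. }
      set (q := dx u - k * (x u - e)).
      assert (0 <= q^2 - 2 * c * E u * q + c^2).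
      { assert (0 <= (q - c * E u)^2) by apply pow2_ge_0.
        assert (0 <= c^2 * (1 - (E u)^2)) by (apply Rmult_le_pos; nra). nra. }
      assert (0 <= a^2 * b^2) by nra. nra. }
  assert (hc : c * a = E t * (x t - e)) by (unfold c; field; lra).
  unfold P in h; rewrite <- he in h.
  assert (h2 : a^2 * b^2 * (2 * c * (E t * (x t - e)) - c^2 * a)
      = a * b^2 * (E t)^2 * (x t - e)^2).
  { rewrite <- hc. transitivity (a * b^2 * (c * a)^2); [ring |]. rewrite hc; ring. }
  nra.
Qed.

(* With [v = u - (t - b)] and [k = (a + b) / b^2], the function
   [p = - k v / (1 - k v)] solves [p' + p^2 / v <= - k], so that
   [v x'^2 - k (x - e)^2 >= (p (x - e)^2)']; it is defined up to [v = b - a]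
   because [k (b - a) < 1]. *)
Lemma linear_weight_hardy (a b e t : R) (x dx X X2 G H : R -> R) :
  0 < a < b -> b < t -> e = x (t - a) ->
  (forall t, 0 < t -> is_derive x t (dx t)) ->
  (forall t, 0 < t -> is_derive X t (x t)) ->
  (forall t, 0 < t -> is_derive X2 t ((x t)^2)) ->
  (forall t, 0 < t -> is_derive G t ((dx t)^2)) ->
  (forall t, 0 < t -> is_derive H t (G t)) ->
  (a + b) * (X2 (t - a) - X2 (t - b) - 2 * e * (X (t - a) - X (t - b)) + e^2 * (b - a))
  <= b^2 * ((b - a) * G (t - a) - H (t - a) + H (t - b)).
Proof.
  intros hab ht he hx hX hX2 hG hH.
  set (k := (a + b) / b^2).
  assert (hk : b^2 * k = a + b) by (unfold k; field; lra).
  assert (hk0 : 0 < k) by (unfold k; apply Rdiv_lt_0_compat; nra).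
  assert (hk1 : k * (b - a) < 1).
  { apply (Rmult_lt_reg_l (b^2)); nra. }
  set (P := fun u => (u - (t - b)) * G u - H u - k * (X2 u - 2 * e * X u + e^2 * u)
     + k * (u - (t - b)) / (1 - k * (u - (t - b))) * (x u - e)^2).
  assert (h : P (t - b) <= P (t - a)).
  { apply (derive_nonneg_le P (fun u =>
      (u - (t - b)) * (dx u + k / (1 - k * (u - (t - b))) * (x u - e))^2
      + (k / (1 - k * (u - (t - b))) - k) * (x u - e)^2)); [lra | |]; intros u hu;
      assert (hv : 0 < 1 - k * (u - (t - b))) by nra.
    - unfold P; auto_derive.
      + known_ex_derive.
        unfold Rminus in hv; lra.
      + known_derive.
        field; lra.
    - assert (hkk : k <= k / (1 - k * (u - (t - b)))).
      { apply (Rmult_le_reg_r (1 - k * (u - (t - b)))); [exact hv |].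
        unfold Rdiv; rewrite Rmult_assoc, Rinv_l, Rmult_1_r; [| lra].
        assert (0 <= k * (u - (t - b))) by (apply Rmult_le_pos; lra). nra. }
      apply Rplus_le_le_0_compat; apply Rmult_le_pos; try apply pow2_ge_0; lra. }
  (* The boundary term of [P] vanishes at both ends: at [t - b] its weight is zero, and at [t - a]
     the factor [x - e] is zero. *)
  unfold P in h; rewrite <- he in h.
  replace (t - b - (t - b)) with 0 in h by ring.
  replace (e - e) with 0 in h by ring.
  replace (t - a - (t - b)) with (b - a) in h by ring.
  unfold Rdiv in h; rewrite !Rmult_0_r, !Rmult_0_l in h.
  rewrite <- hk.
  apply (Rmult_le_compat_l (b^2)) in h; [| nra].
  lra.
Qed.

(* A first integral of the normalized equation. It vanishes on constants and on
   linear functions, but not on [t^2]. *)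
Definition drift (a b : R) (x X : R -> R) (t : R) : R :=
  a * b * (b - a) * x t - b^2 * (X t - X (t - a)) + a^2 * (X t - X (t - b)).

Lemma gap_energy_lower (a b t : R) (x dx X X2 G H : R -> R) :
  0 < a < b -> b < t ->
  (forall t, 0 < t -> is_derive x t (dx t)) ->
  (forall t, 0 < t -> is_derive X t (x t)) ->
  (forall t, 0 < t -> is_derive X2 t ((x t)^2)) ->
  (forall t, 0 < t -> is_derive G t ((dx t)^2)) ->
  (forall t, 0 < t -> is_derive H t (G t)) ->
  drift a b x X t = 0 ->
  (b - a)^2 * (a * b^2 * (exp (- ((a + b) / b)))^2) * (x t - x (t - a))^2
  <= gap_energy a b x X2 G H t.
Proof.
  intros hab ht hx hX hX2 hG hH h0.
  set (e := x (t - a)).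
  assert (h1 := exp_weighted_bound a b e t x dx X X2 G hab ltac:(lra) eq_refl hx hX hX2 hG).
  assert (h2 := linear_weight_hardy a b e t x dx X X2 G H hab ht eq_refl hx hX hX2 hG hH).
  apply (Rmult_le_compat_l ((b - a)^2)) in h1; [| apply pow2_ge_0].
  apply (Rmult_le_compat_l (a^2 * (b - a))) in h2; [| apply Rmult_le_pos; nra].
  rewrite Rmult_assoc.
  eapply Rle_trans; [exact h1 |].
  apply Rminus_le; apply Rle_minus in h2.
  eapply Rle_trans; [| exact h2]; right.
  (* The functional is the combination of the two lower bounds up to this multiple of [drift], which
     is the whole cost of centring [x] at [e]. *)
  transitivity (2 * e * (b^2 - a^2) * drift a b x X t
    + (a ^ 2 * (b - a) *
      ((a + b) * (X2 (t - a) - X2 (t - b) - 2 * e * (X (t - a) - X (t - b)) + e ^ 2 * (b - a)))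
     - a ^ 2 * (b - a) * (b ^ 2 * ((b - a) * G (t - a) - H (t - a) + H (t - b))))).
  - unfold drift, gap_energy; ring.
  - rewrite h0; ring.
Qed.

(** * Quadratic growth for the normalized equation *)

Lemma increment_le (F f : R -> R) (K u v : R) :
  u <= v ->
  (forall t, u <= t <= v -> is_derive F t (f t)) ->
  (forall t, u <= t <= v -> f t <= K) ->
  F v - F u <= K * (v - u).
Proof.
  intros huv hF hK.
  enough (K * u - F u <= K * v - F v) by lra.
  apply (derive_nonneg_le (fun t => K * t - F t) (fun t => K - f t)); auto; intros t ht.
  - auto_derive; [known_ex_derive | known_derive; ring].
  - specialize (hK t ht); lra.
Qed.

Lemma increment_ge (F f : R -> R) (K u v : R) :
  u <= v ->
  (forall t, u <= t <= v -> is_derive F t (f t)) ->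
  (forall t, u <= t <= v -> K <= f t) ->
  K * (v - u) <= F v - F u.
Proof.
  intros huv hF hK.
  enough (F u - K * u <= F v - K * v) by lra.
  apply (derive_nonneg_le (fun t => F t - K * t) (fun t => f t - K)); auto; intros t ht.
  - auto_derive; [known_ex_derive | known_derive; ring].
  - specialize (hK t ht); lra.
Qed.

Lemma Rabs_le_sq (x m : R) : Rabs x <= m -> x^2 <= m^2.
Proof. intros h; apply Rabs_le_between in h; nra. Qed.

Lemma sq_le_Rabs (x m : R) : 0 <= m -> x^2 <= m^2 -> Rabs x <= m.
Proof. intros hm h; apply Rabs_le; split; nra. Qed.

Lemma gap_energy_upper (a b t M : R) (x dx X2 G H : R -> R) :
  0 < a < b -> b < t ->
  (forall t, 0 < t -> is_derive X2 t ((x t)^2)) ->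
  (forall t, 0 < t -> is_derive G t ((dx t)^2)) ->
  (forall t, 0 < t -> is_derive H t (G t)) ->
  (forall u, t - b <= u <= t -> Rabs (x u) <= M /\ Rabs (dx u) <= M) ->
  gap_energy a b x X2 G H t <= (b^5 + b^7) * M^2.
Proof.
  intros hab ht hX2 hG hH hM.
  assert (h1 : X2 t - X2 (t - a) <= M^2 * a).
  { replace a with (t - (t - a)) at 2 by ring.
    apply (increment_le _ (fun u => (x u)^2)); [lra | |]; intros u hu;
      [apply hX2; lra | apply Rabs_le_sq, hM; lra]. }
  assert (h2 : 0 <= X2 t - X2 (t - b)).
  { rewrite <- (Rmult_0_l (t - (t - b))).
    apply (increment_ge _ (fun u => (x u)^2)); [lra | |]; intros u hu;
      [apply hX2; lra | apply pow2_ge_0]. }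
  assert (h3 : G t - G (t - b) <= M^2 * b).
  { replace b with (t - (t - b)) at 2 by ring.
    apply (increment_le _ (fun u => (dx u)^2)); [lra | |]; intros u hu;
      [apply hG; lra | apply Rabs_le_sq, hM; lra]. }
  (* [G] is nondecreasing, so on [[t - b, t - a]] its primitive [H] grows at least at the rate
     [G (t - b)]. *)
  assert (h4 : G (t - b) * (b - a) <= H (t - a) - H (t - b)).
  { replace (b - a) with (t - a - (t - b)) by ring.
    apply (increment_ge _ G); [lra | |]; intros u hu; [apply hH; lra |].
    apply (derive_nonneg_le _ (fun u => (dx u)^2)); [lra | |]; intros v hv;
      [apply hG; lra | apply pow2_ge_0]. }
  assert (hM2 : 0 <= M^2) by apply pow2_ge_0.
  assert (ha2 : 0 < a^2 <= b^2) by nra.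
  assert (hal : 0 <= b^2 - a^2 <= b^2) by lra.
  unfold gap_energy.
  assert (k1 : (b^2 - a^2) * b^2 * (X2 t - X2 (t - a)) <= b^5 * M^2).
  { apply Rle_trans with ((b^2 - a^2) * b^2 * (M^2 * a)).
    - apply Rmult_le_compat_l; nra.
    - replace (b^5 * M^2) with (b^2 * b^2 * (M^2 * b)) by ring.
      apply Rmult_le_compat; try nra. }
  assert (k2 : 0 <= (b^2 - a^2) * a^2 * (X2 t - X2 (t - b))).
  { apply Rmult_le_pos; nra. }
  assert (k3 : 0 <= (b^2 - a^2) * (a * b * (b - a)) * (x t)^2).
  { apply Rmult_le_pos; [repeat apply Rmult_le_pos; lra | apply pow2_ge_0]. }
  assert (k4 : a^2 * b^2 * (b - a) * ((b - a) * G t - H (t - a) + H (t - b)) <= b^7 * M^2).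
  { apply Rle_trans with (a^2 * b^2 * (b - a) * ((b - a) * (M^2 * b))).
    - apply Rmult_le_compat_l; [apply Rmult_le_pos; nra |].
      apply Rle_trans with ((b - a) * (G t - G (t - b))); [lra |].
      apply Rmult_le_compat_l; lra.
    - replace (b^7 * M^2) with (b^2 * b^2 * b * (b * (M^2 * b))) by ring.
      assert (0 <= M^2 * b) by nra.
      assert (0 <= a^2 * b^2 * (b - a)) by (repeat apply Rmult_le_pos; lra).
      assert (0 <= (b - a) * (M^2 * b)) by (apply Rmult_le_pos; lra).
      apply Rmult_le_compat; try lra.
      + apply Rmult_le_compat; try lra; [apply Rmult_le_pos; lra |].
        apply Rmult_le_compat; lra.
      + apply Rmult_le_compat_r; lra. }
  lra.
Qed.

(* The equation satisfied by [e^(-s0 t) y(t)], multiplied by [a b (b - a)], when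
   [s0] is a triple root. *)
Definition normalized_solution (a b : R) (x dx : R -> R) : Prop :=
  (forall t, 0 < t -> is_derive x t (dx t)) /\
  (forall t, 0 < t -> continuous dx t) /\
  (forall t, b < t ->
    a * b * (b - a) * dx t = (b^2 - a^2) * x t - b^2 * x (t - a) + a^2 * x (t - b)).

Lemma drift_constant (a b : R) (x dx X : R -> R) (u v : R) :
  0 < a < b -> normalized_solution a b x dx ->
  (forall t, 0 < t -> is_derive X t (x t)) ->
  b < u <= v -> drift a b x X u = drift a b x X v.
Proof.
  intros hab [hx [_ heq]] hX huv.
  apply derive_zero_eq; [lra |]; intros t ht; unfold drift.
  auto_derive; [known_ex_derive | known_derive].
  specialize (heq t ltac:(lra)); unfold Rminus in *; lra.
Qed.

(** The functional at [t] is at least [c] times the squared increment, and at most its value at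
    [2 * b], which the data on [[b, 2 * b]] control. Starting at [2 * b] keeps that window inside
    [t > 0], where [x] is differentiable. [K] depends on the delays only, as uniform stability
    requires. *)
Lemma increment_of_drift_zero (a b : R) :
  0 < a < b ->
  exists K, 0 <= K /\
  forall (x dx X : R -> R) (M : R),
    normalized_solution a b x dx ->
    (forall t, 0 < t -> is_derive X t (x t)) ->
    drift a b x X (2 * b) = 0 ->
    (forall u, b <= u <= 2 * b -> Rabs (x u) <= M /\ Rabs (dx u) <= M) ->
    forall t, 2 * b <= t -> Rabs (x t - x (t - a)) <= K * M.
Proof.
  intros hab.
  set (c := (b - a)^2 * (a * b^2 * (exp (- ((a + b) / b)))^2)).
  assert (hc : 0 < c).
  { unfold c; assert (0 < exp (- ((a + b) / b))) by apply exp_pos.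
    repeat apply Rmult_lt_0_compat; try lra; apply pow_lt; lra. }
  assert (hU : 0 <= b^5 + b^7).
  { assert (0 < b^5) by (apply pow_lt; lra); assert (0 < b^7) by (apply pow_lt; lra); lra. }
  exists (sqrt ((b^5 + b^7) / c)); split; [apply sqrt_pos |].
  intros x dx X M hs hX h0 hM t ht.
  assert (hs' := hs); destruct hs' as [hx [hdx heq]].
  assert (hM0 : 0 <= M).
  { apply Rle_trans with (Rabs (x b)); [apply Rabs_pos | apply hM; lra]. }
  destruct (primitive_exists (fun t => (x t)^2) 0) as [X2 hX2].
  { intros u hu; apply (ex_derive_continuous (fun t => (x t)^2)); auto_derive; known_ex_derive. }
  destruct (primitive_exists (fun t => (dx t)^2) 0) as [G hG].
  { intros u hu; apply (continuous_comp dx (fun z => z^2)); [now apply hdx |].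
    apply (ex_derive_continuous (fun z => z^2)); auto_derive; auto. }
  destruct (primitive_exists G 0) as [H hH].
  { intros u hu; apply (ex_derive_continuous G); eexists; apply hG; lra. }
  assert (hl : c * (x t - x (t - a))^2 <= gap_energy a b x X2 G H t).
  { apply (gap_energy_lower a b t x dx X X2 G H); auto; try lra.
    rewrite <- h0; symmetry; apply (drift_constant a b x dx); auto; lra. }
  assert (hm := gap_energy_mono a b x dx X2 G H (2 * b) t hab hx heq hX2 hG hH ltac:(lra)).
  assert (hu := gap_energy_upper a b (2 * b) M x dx X2 G H hab ltac:(lra) hX2 hG hH).
  assert (hu' := hu ltac:(intros u huu; apply hM; lra)).
  apply sq_le_Rabs.
  - apply Rmult_le_pos; [apply sqrt_pos | exact hM0].
  - rewrite Rpow_mult_distr, pow2_sqrt;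
      [| apply Rmult_le_pos; [exact hU | left; now apply Rinv_0_lt_compat]].
    apply (Rmult_le_reg_l c); [exact hc |].
    replace (c * ((b^5 + b^7) / c * M^2)) with ((b^5 + b^7) * M^2) by (field; lra).
    lra.
Qed.

Lemma linear_growth (x : R -> R) (a T D M : R) :
  0 < a -> 0 <= D ->
  (forall t, T - a <= t <= T -> Rabs (x t) <= M) ->
  (forall t, T <= t -> Rabs (x t - x (t - a)) <= D) ->
  forall t, T - a <= t -> Rabs (x t) <= M + D * ((t - T + a) / a).
Proof.
  intros ha hD hM hd.
  (* Induction on the number of steps of length [a] from the initial window; each step costs at most
     [D]. *)
  assert (h : forall n t, T - a <= t <= T + INR n * a ->
    Rabs (x t) <= M + D * ((t - T + a) / a)).
  { induction n as [| n IH]; intros t ht.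
    - simpl in ht; rewrite Rmult_0_l in ht; specialize (hM t ltac:(lra)).
      assert (0 <= D * ((t - T + a) / a)); [| lra].
      apply Rmult_le_pos; [exact hD |]; apply Rmult_le_pos; [lra |].
      left; now apply Rinv_0_lt_compat.
    - rewrite S_INR in ht; destruct (Rle_lt_dec t (T + INR n * a)); [apply IH; lra |].
      assert (hn := pos_INR n).
      assert (htT : T <= t) by nra.
      specialize (IH (t - a) ltac:(lra)); specialize (hd t htT).
      replace (x t) with (x (t - a) + (x t - x (t - a))) by ring.
      eapply Rle_trans; [apply Rabs_triang |].
      replace (D * ((t - T + a) / a)) with (D * ((t - a - T + a) / a) + D) by (field; lra).
      lra. }
  intros t ht; destruct (nfloor_ex (Rmax 0 ((t - T) / a)) (Rmax_l _ _)) as [n hn].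
  apply (h (S n)); split; [exact ht |].
  rewrite S_INR; assert (hm := Rmax_r 0 ((t - T) / a)).
  assert (hlt : (t - T) / a < INR n + 1) by lra.
  apply (Rmult_lt_compat_r a) in hlt; [| exact ha].
  replace ((t - T) / a * a) with (t - T) in hlt by (field; lra). lra.
Qed.

Lemma quadratic_growth (a b : R) :
  0 < a < b ->
  exists K, 0 <= K /\
  forall (x dx : R -> R) (M : R),
    normalized_solution a b x dx ->
    (forall u, b <= u <= 2 * b -> Rabs (x u) <= M /\ Rabs (dx u) <= M) ->
    forall t, 2 * b <= t -> Rabs (x t) <= K * M * (1 + t)^2.
Proof.
  intros hab; destruct (increment_of_drift_zero a b hab) as [K [hK hinc]].
  (* [c0 * M] will bound the coefficient [c] of [t^2], because the drift at [2 * b] is at most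
     [2 a b^2 M]. Then [N * M] bounds [x - c t^2] and its derivative on [[b, 2 * b]], where [c t^2]
     and [2 c t] are at most [4 c0 b^2 M] and [4 c0 b M]. *)
  set (c0 := 6 / (a * (b - a))).
  assert (hc0 : 0 < c0) by (apply Rdiv_lt_0_compat; nra).
  set (N := 1 + 4 * c0 * (b^2 + b)).
  assert (hN : 1 <= N) by (unfold N; nra).
  exists (N * (1 + K / a) + c0).
  assert (hKa : 0 <= K / a).
  { apply Rmult_le_pos; [exact hK | left; apply Rinv_0_lt_compat; lra]. }
  split; [nra |].
  intros x dx M hs hM t ht.
  assert (hs' := hs); destruct hs' as [hx [hdx heq]].
  assert (hM0 : 0 <= M).
  { apply Rle_trans with (Rabs (x b)); [apply Rabs_pos | apply hM; lra]. }
  destruct (primitive_exists x 0) as [X hX].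
  { intros u hu; apply (ex_derive_continuous x); eexists; apply hx; lra. }
  (* The drift of [t^2] is the constant [a^2 b^2 (b - a) / 3], so subtracting [c t^2] brings the
     drift to zero. *)
  set (c := 3 * drift a b x X (2 * b) / (a^2 * b^2 * (b - a))).
  assert (hX' : forall s, 0 < s <= b -> - M * s <= X (2 * b) - X (2 * b - s) <= M * s).
  { intros s hss; replace s with (2 * b - (2 * b - s)) at 1 4 by ring; split;
      [apply (increment_ge _ x) | apply (increment_le _ x)]; try lra;
      intros u hu; try (apply hX; lra);
      assert (h := proj1 (hM u ltac:(lra))); apply Rabs_le_between in h; lra. }
  assert (hc : Rabs c <= c0 * M).
  { assert (hdr : Rabs (drift a b x X (2 * b)) <= 2 * a * b^2 * M).
    { unfold drift.
      assert (h1 := hX' a ltac:(lra)); assert (h2 := hX' b ltac:(lra)).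
      assert (h3 := proj1 (hM (2 * b) ltac:(lra))); apply Rabs_le_between in h3.
      assert (p1 : 0 < a * b * (b - a)) by (repeat apply Rmult_lt_0_compat; lra).
      assert (p2 : 0 < b^2) by nra. assert (p3 : 0 < a^2) by nra.
      apply Rabs_le; split; nra. }
    unfold c, c0, Rdiv.
    assert (hp : 0 < a^2 * b^2 * (b - a)).
    { repeat apply Rmult_lt_0_compat; try lra; apply pow_lt; lra. }
    rewrite Rabs_mult, (Rabs_pos_eq (/ _)), Rabs_mult, (Rabs_pos_eq 3);
      [| lra | left; now apply Rinv_0_lt_compat].
    apply (Rmult_le_reg_r (a^2 * b^2 * (b - a))); [exact hp |].
    rewrite Rmult_assoc, Rinv_l, Rmult_1_r; [| lra].
    replace (6 * / (a * (b - a)) * M * (a^2 * b^2 * (b - a))) with (3 * (2 * a * b^2 * M))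
      by (field; lra). lra. }
  assert (hsol : normalized_solution a b (fun t => x t - c * t^2) (fun t => dx t - 2 * c * t)).
  { split; [| split].
    - intros u hu; auto_derive; [known_ex_derive | known_derive; ring].
    - intros u hu; apply (continuous_minus dx (fun t => 2 * c * t)); [now apply hdx |].
      apply (ex_derive_continuous (fun t => 2 * c * t)); auto_derive; auto.
    - intros u hu; specialize (heq u hu); rewrite Rmult_minus_distr_l, heq; ring. }
  assert (hXsol : forall t, 0 < t -> is_derive (fun t => X t - c * t^3 / 3) t (x t - c * t^2)).
  { intros u hu; auto_derive; [known_ex_derive | known_derive; field]. }
  assert (h0 : drift a b (fun t => x t - c * t^2) (fun t => X t - c * t^3 / 3) (2 * b) = 0).
  { transitivity (drift a b x X (2 * b) - c * (a^2 * b^2 * (b - a)) / 3).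
    - unfold drift; field.
    - unfold c; field; repeat split; lra. }
  assert (hbnd : forall u, b <= u <= 2 * b ->
    Rabs (x u - c * u^2) <= M * N /\ Rabs (dx u - 2 * c * u) <= M * N).
  { intros u hu; destruct (hM u hu) as [h1 h2].
    assert (hcM : 0 <= c0 * M) by (apply Rmult_le_pos; lra).
    assert (0 <= c0 * M * b) by (apply Rmult_le_pos; lra).
    assert (0 <= c0 * M * b^2) by (apply Rmult_le_pos; [lra | apply pow2_ge_0]).
    unfold N; split.
    - eapply Rle_trans; [apply Rabs_triang |]; rewrite Rabs_Ropp, Rabs_mult.
      rewrite (Rabs_pos_eq (u^2)) by apply pow2_ge_0.
      assert (Rabs c * u^2 <= c0 * M * (2 * b)^2).
      { apply Rmult_le_compat; auto using Rabs_pos, pow2_ge_0; apply pow_incr; lra. }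
      lra.
    - eapply Rle_trans; [apply Rabs_triang |]; rewrite Rabs_Ropp, !Rabs_mult.
      rewrite (Rabs_pos_eq u), (Rabs_pos_eq 2) by lra.
      assert (Rabs c * u <= c0 * M * (2 * b)).
      { apply Rmult_le_compat; auto using Rabs_pos; lra. }
      lra. }
  assert (hg := linear_growth (fun t => x t - c * t^2) a (2 * b) (K * (M * N)) (M * N)
    ltac:(lra) ltac:(apply Rmult_le_pos; [lra | apply Rmult_le_pos; lra])
    ltac:(intros u hu; apply hbnd; lra)
    (hinc _ _ _ _ hsol hXsol h0 hbnd) t ltac:(lra)); simpl in hg.
  replace (x t) with (x t - c * (t * (t * 1)) + c * t^2) by ring.
  eapply Rle_trans; [apply Rabs_triang |].
  assert (hct : Rabs (c * t^2) <= c0 * M * (1 + t)^2).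
  { rewrite Rabs_mult, (Rabs_pos_eq (t^2)) by apply pow2_ge_0.
    apply Rmult_le_compat; auto using Rabs_pos, pow2_ge_0; apply pow_incr; lra. }
  assert (hMN : 0 <= M * N) by (apply Rmult_le_pos; lra).
  assert (hq : K * (M * N) * ((t - 2 * b + a) / a) <= M * N * (K / a) * (1 + t)^2).
  { replace (K * (M * N) * ((t - 2 * b + a) / a))
      with (M * N * (K / a) * (t - 2 * b + a)) by (field; lra).
    apply Rmult_le_compat_l; [apply Rmult_le_pos; lra | nra]. }
  assert (M * N <= M * N * (1 + t)^2) by nra.
  nra.
Qed.

(** * Coefficients of a triple root, and roots on the line Re s = s0 *)

(** The real part of the complex remainder is at most its modulus. This lets the abstract
    derivatives [D k] be computed along the real axis by real calculus. *)
Lemma is_derive_Re (f : C -> C) (x : R) (l : C) :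
  is_derive (K := C_AbsRing) (V := C_NormedModule) f (RtoC x) l ->
  is_derive (fun u : R => Re (f (RtoC u))) x (Re l).
Proof.
  intros [_ h]; split; [apply is_linear_scal_l |]; intros y hy.
  apply (is_filter_lim_locally_unique (V := AbsRing_NormedModule R_AbsRing)) in hy; subst y; intros eps.
  destruct (h (RtoC x) (fun P hP => hP) eps) as [d hd].
  exists d; intros u hu; specialize (hd (RtoC u)).
  assert (hux : Cmod (RtoC u - RtoC x) = Rabs (u - x)).
  { rewrite <- RtoC_minus; apply Cmod_R. }
  specialize (hd ltac:(change (Cmod (RtoC u - RtoC x) < d); rewrite hux; exact hu)).
  change (Cmod (f u - f x - (RtoC u - RtoC x) * l)%C <= eps * Cmod (RtoC u - RtoC x)%C) in hd.
  rewrite hux in hd.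
  eapply Rle_trans; [| exact hd].
  eapply Rle_trans; [| apply Rmax_Cmod].
  eapply Rle_trans; [| apply Rmax_l].
  right; change (Rabs (Re (f u) - Re (f x) - (u - x) * Re l) =
    Rabs (Re (f u) + - Re (f x) + - ((u + - x) * Re l - (0 + - 0) * Im l))).
  f_equal; ring.
Qed.

Lemma char_fun_Re (a0 a1 a2 tau1 tau2 sigma omega : R) :
  Re (char_fun a0 a1 a2 tau1 tau2 (sigma, omega)) =
  sigma + a0 + a1 * exp (- sigma * tau1) * cos (omega * tau1)
    + a2 * exp (- sigma * tau2) * cos (omega * tau2).
Proof.
  unfold char_fun, Cexp; simpl.
  rewrite !Rmult_0_r, !Rmult_0_l, !Rminus_0_r, !Rplus_0_l, !cos_neg.
  replace (- (sigma * tau1)) with (- sigma * tau1) by ring.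
  replace (- (sigma * tau2)) with (- sigma * tau2) by ring. ring.
Qed.

Lemma char_fun_Im (a0 a1 a2 tau1 tau2 sigma omega : R) :
  Im (char_fun a0 a1 a2 tau1 tau2 (sigma, omega)) =
  omega - a1 * exp (- sigma * tau1) * sin (omega * tau1)
    - a2 * exp (- sigma * tau2) * sin (omega * tau2).
Proof.
  unfold char_fun, Cexp; simpl.
  rewrite !Rmult_0_r, !Rmult_0_l, !Rminus_0_r, !Rplus_0_l, !sin_neg.
  replace (- (sigma * tau1)) with (- sigma * tau1) by ring.
  replace (- (sigma * tau2)) with (- sigma * tau2) by ring. ring.
Qed.

(** The solution of the linear system stating that the characteristic function and its first two
    derivatives vanish at [s0], cleared of denominators. *)
Definition triple_root_coeffs (a0 a1 a2 tau1 tau2 s0 : R) : Prop :=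
  let beta := tau1 * tau2 * (tau2 - tau1) in
  beta * (s0 + a0) = tau1^2 - tau2^2 /\
  beta * (a1 * exp (- s0 * tau1)) = tau2^2 /\
  beta * (a2 * exp (- s0 * tau2)) = - tau1^2.

Lemma triple_root_coeffs_of_multiplicity (a0 a1 a2 tau1 tau2 s0 : R) :
  0 < tau1 < tau2 ->
  root_of_multiplicity 3 (char_fun a0 a1 a2 tau1 tau2) (RtoC s0) ->
  triple_root_coeffs a0 a1 a2 tau1 tau2 s0.
Proof.
  intros htau [D [hD0 [hD [hroot _]]]].
  assert (hR : forall k x, is_derive (fun u : R => Re (D k (RtoC u))) x (Re (D (S k) (RtoC x))))
    by (intros k x; apply is_derive_Re, hD).
  assert (h0 : forall x, Re (D 0%nat (RtoC x)) =
    x + a0 + a1 * exp (- x * tau1) + a2 * exp (- x * tau2)).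
  { intros x; rewrite hD0; unfold RtoC; rewrite char_fun_Re, !Rmult_0_l, cos_0; ring. }
  assert (h1 : forall x, Re (D 1%nat (RtoC x)) =
    1 - a1 * tau1 * exp (- x * tau1) - a2 * tau2 * exp (- x * tau2)).
  { intros x; rewrite <- (is_derive_unique _ _ _ (hR 0%nat x)).
    rewrite (Derive_ext _ _ x h0); apply is_derive_unique; auto_derive; [auto | ring]. }
  assert (h2 : forall x, Re (D 2%nat (RtoC x)) =
    a1 * tau1^2 * exp (- x * tau1) + a2 * tau2^2 * exp (- x * tau2)).
  { intros x; rewrite <- (is_derive_unique _ _ _ (hR 1%nat x)).
    rewrite (Derive_ext _ _ x h1); apply is_derive_unique; auto_derive; [auto | ring]. }
  specialize (h0 s0); specialize (h1 s0); specialize (h2 s0).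
  rewrite hroot in h0, h1, h2 by auto; simpl in h0, h1, h2.
  set (b1 := a1 * exp (- s0 * tau1)); set (b2 := a2 * exp (- s0 * tau2)).
  assert (e0 : s0 + a0 + b1 + b2 = 0) by (unfold b1, b2; lra).
  assert (e1 : b1 * tau1 + b2 * tau2 = 1) by (unfold b1, b2; lra).
  assert (e2 : b1 * tau1^2 + b2 * tau2^2 = 0) by (unfold b1, b2; lra).
  assert (k1 : tau1 * (tau2 - tau1) * b1 = tau2).
  { transitivity (tau2 * (b1 * tau1 + b2 * tau2) - (b1 * tau1^2 + b2 * tau2^2)); [ring |].
    rewrite e1, e2; ring. }
  assert (k2 : tau2 * (tau2 - tau1) * b2 = - tau1).
  { transitivity ((b1 * tau1^2 + b2 * tau2^2) - tau1 * (b1 * tau1 + b2 * tau2)); [ring |].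
    rewrite e1, e2; ring. }
  assert (m1 : tau1 * tau2 * (tau2 - tau1) * b1 = tau2^2).
  { transitivity (tau2 * (tau1 * (tau2 - tau1) * b1)); [ring | rewrite k1; ring]. }
  assert (m2 : tau1 * tau2 * (tau2 - tau1) * b2 = - tau1^2).
  { transitivity (tau1 * (tau2 * (tau2 - tau1) * b2)); [ring | rewrite k2; ring]. }
  repeat split; auto.
  replace (s0 + a0) with (- b1 - b2) by lra; lra.
Qed.

Lemma sin_sq_lt (h : R) : 0 < h -> (sin h)^2 < h^2.
Proof.
  intros hh; assert (h1 := sin_lt_x h hh); assert (h2 := SIN_bound h).
  assert (h3 : - h < sin h).
  { destruct (Rlt_le_dec h PI) as [hp | hp].
    - assert (h3 := sin_gt_0 h hh hp); lra.
    - assert (h3 := PI2_1); lra. }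
  nra.
Qed.

Lemma cos_gt_parabola (theta : R) : theta <> 0 -> 2 * (1 - cos theta) < theta^2.
Proof.
  intros ht.
  assert (h : forall x, 0 < x -> 2 * (1 - cos x) < x^2).
  { intros x hx; assert (hs := sin_sq_lt (x / 2) ltac:(lra)).
    replace (cos x) with (1 - 2 * sin (x / 2) * sin (x / 2)); [nra |].
    rewrite <- cos_2a_sin; f_equal; field. }
  destruct (Rtotal_order theta 0) as [hn | [hz | hp]]; [| easy | now apply h].
  specialize (h (- theta) ltac:(lra)); rewrite cos_neg in h; nra.
Qed.

Lemma no_other_root_on_line (a0 a1 a2 tau1 tau2 s0 omega : R) :
  0 < tau1 < tau2 ->
  triple_root_coeffs a0 a1 a2 tau1 tau2 s0 ->
  char_fun a0 a1 a2 tau1 tau2 (s0, omega) = RtoC 0 ->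
  omega = 0.
Proof.
  intros htau [c0 [c1 c2]] hroot.
  assert (hre := char_fun_Re a0 a1 a2 tau1 tau2 s0 omega).
  assert (him := char_fun_Im a0 a1 a2 tau1 tau2 s0 omega).
  rewrite hroot in hre, him; simpl in hre, him.
  set (beta := tau1 * tau2 * (tau2 - tau1)) in *.
  assert (er : tau2^2 * cos (omega * tau1) - tau1^2 * cos (omega * tau2) = tau2^2 - tau1^2).
  { apply (f_equal (Rmult beta)) in hre.
    replace (tau1 ^ 2 * cos (omega * tau2)) with (- (- tau1^2 * cos (omega * tau2))) by ring.
    rewrite <- c2, <- c1; lra. }
  assert (ei : tau2^2 * sin (omega * tau1) - tau1^2 * sin (omega * tau2) = beta * omega).
  { apply (f_equal (Rmult beta)) in him.
    replace (tau1 ^ 2 * sin (omega * tau2)) with (- (- tau1^2 * sin (omega * tau2))) by ring.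
    rewrite <- c2, <- c1; lra. }
  destruct (Req_dec omega 0) as [| hw]; [easy | exfalso].
  assert (hcos := cos_gt_parabola (omega * (tau2 - tau1)) ltac:(apply Rmult_integral_contrapositive; split; lra)).
  assert (hcm : cos (omega * (tau2 - tau1)) =
    cos (omega * tau1) * cos (omega * tau2) + sin (omega * tau1) * sin (omega * tau2)).
  { rewrite Rmult_minus_distr_l, cos_minus; ring. }
  assert (s1 := sin2_cos2 (omega * tau1)); assert (s2 := sin2_cos2 (omega * tau2)).
  unfold Rsqr in s1, s2.
  (* Both sides equal the squared modulus of [tau2^2 e^(i omega tau1) - tau1^2 e^(i omega tau2)]
     minus [(tau2^2 - tau1^2)^2]: once by expansion, once by [er] and [ei]. *)
  assert (e : tau1^2 * tau2^2 * (2 * (1 - cos (omega * (tau2 - tau1))))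
    = tau1^2 * tau2^2 * (omega * (tau2 - tau1))^2).
  { transitivity ((tau2^2 * cos (omega * tau1) - tau1^2 * cos (omega * tau2))^2
      + (tau2^2 * sin (omega * tau1) - tau1^2 * sin (omega * tau2))^2 - (tau2^2 - tau1^2)^2).
    - rewrite hcm.
      transitivity (tau2^4 * (sin (omega * tau1) * sin (omega * tau1) + cos (omega * tau1) * cos (omega * tau1))
        + tau1^4 * (sin (omega * tau2) * sin (omega * tau2) + cos (omega * tau2) * cos (omega * tau2))
        - 2 * tau1^2 * tau2^2 * (cos (omega * tau1) * cos (omega * tau2) + sin (omega * tau1) * sin (omega * tau2))
        - (tau2^2 - tau1^2)^2); [rewrite s1, s2; ring | ring].
    - rewrite er, ei; unfold beta; ring. }
  apply Rmult_eq_reg_l in e; [lra |].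
  apply Rmult_integral_contrapositive; split; apply pow_nonzero; lra.
Qed.

(** * Growth of solutions *)

(** Solutions are continuous only relative to a half-line. Freezing the function to the left of [c]
    makes it continuous everywhere without changing it on the half-line. *)
Lemma continuous_clamp (f : R -> R) (c : R) :
  continuous_on (fun t => c <= t) f ->
  forall t, continuous (fun u => f (Rmax c u)) t.
Proof.
  intros hf t.
  apply (filterlim_comp _ _ _ (Rmax c) f _
    (within (fun u => c <= u) (locally (Rmax c t)))); [| apply hf, Rmax_l].
  intros P [d hd]; exists d; intros u hu.
  apply hd; [| apply Rmax_l].
  change (Rabs (u - t) < d) in hu; change (Rabs (Rmax c u - Rmax c t) < d).
  apply Rabs_lt_between in hu; apply Rabs_lt_between.
  unfold Rmax; destruct (Rle_dec c u), (Rle_dec c t); lra.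
Qed.

(** [sup_abs] passes through [real], which sends an infinite supremum to [0]; the bound [M] excludes
    that case. *)
Lemma le_sup_abs (phi : R -> R) (a b M : R) :
  (forall t, a <= t <= b -> Rabs (phi t) <= M) ->
  forall t, a <= t <= b -> Rabs (phi t) <= sup_abs a b phi.
Proof.
  intros hM t ht; unfold sup_abs.
  destruct (Lub_Rbar_correct (fun r => exists t, a <= t <= b /\ r = Rabs (phi t))) as [hub hlub].
  assert (h1 := hub (Rabs (phi t)) (ex_intro _ t (conj ht eq_refl))).
  assert (h2 := hlub (Finite M)); revert h1 h2.
  destruct (Lub_Rbar _) as [r | |]; simpl; intros h1 h2.
  - exact h1.
  - exfalso; apply h2; intros r [u [hu ->]]; simpl; auto.
  - easy.
Qed.

Lemma clamp_eq_near (c : R) (f : R -> R) (t : R) :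
  c < t -> locally t (fun u => f (Rmax c u) = f u).
Proof.
  intros ht; apply (filter_imp (fun u => c < u)); [| now apply open_gt].
  intros u hu; rewrite Rmax_right; [reflexivity | lra].
Qed.

Lemma solution_bounded_on_history (a0 a1 a2 tau1 tau2 : R) (phi y : R -> R) :
  0 < tau2 -> dde_solution a0 a1 a2 tau1 tau2 phi y ->
  exists M, forall t, - tau2 <= t <= 0 -> Rabs (phi t) <= M.
Proof.
  intros htau [hc [hphi _]].
  destruct (continuity_ab_maj (fun u => Rabs (y (Rmax (- tau2) u))) (- tau2) 0) as [m [hm _]].
  - lra.
  - intros t _; apply continuity_pt_filterlim.
    apply (continuous_comp (fun u => y (Rmax (- tau2) u)) Rabs);
      [apply continuous_clamp, hc | apply continuous_Rabs].
  - exists (Rabs (y (Rmax (- tau2) m))); intros t ht; specialize (hm t ht); simpl in hm.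
    rewrite (Rmax_right (- tau2) t) in hm by lra; rewrite <- hphi; auto.
Qed.

(* Energy estimate for [y^2 + |a1| int_{t-tau1}^t y^2 + |a2| int_{t-tau2}^t y^2]. *)
Lemma solution_a_priori (a0 a1 a2 tau1 tau2 : R) (phi y : R -> R) (S : R) :
  0 < tau1 < tau2 -> dde_solution a0 a1 a2 tau1 tau2 phi y ->
  (forall t, - tau2 <= t <= 0 -> Rabs (phi t) <= S) ->
  forall t, 0 <= t ->
    (y t)^2 <= S^2 * (1 + Rabs a1 * tau1 + Rabs a2 * tau2)
               * exp (2 * (Rabs a0 + Rabs a1 + Rabs a2) * t).
Proof.
  intros htau [hc [hphi heq]] hS T hT.
  set (A := Rabs a0 + Rabs a1 + Rabs a2).
  set (z := fun u => y (Rmax (- tau2) u)).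
  assert (hz : forall t, continuous z t) by now apply continuous_clamp.
  assert (hzy : forall t, - tau2 <= t -> z t = y t)
    by (intros t ht; unfold z; now rewrite Rmax_right).
  (* Starting below [- tau2] makes [P] differentiable at [- tau2] itself. *)
  destruct (primitive_exists (fun t => (z t)^2) (- tau2 - 1)) as [P hP].
  { intros t _; apply (continuous_comp z (fun v => v^2)); [apply hz |].
    apply (ex_derive_continuous (fun v => v^2)); auto_derive; auto. }
  set (dz := fun t => - (a0 * z t + a1 * z (t - tau1) + a2 * z (t - tau2))).
  assert (hdz : forall t, 0 < t -> is_derive z t (dz t)).
  { intros t ht; destruct (heq t ht) as [h1 h2].
    apply (is_derive_ext_loc y).
    - apply (filter_imp (fun u => y (Rmax (- tau2) u) = y u));
        [intros u hu; now symmetry | apply clamp_eq_near; lra].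
    - replace (dz t) with (Derive y t); [now apply Derive_correct |].
      unfold dz; rewrite !hzy by lra; lra. }
  set (V := fun t => (z t)^2 + Rabs a1 * (P t - P (t - tau1)) + Rabs a2 * (P t - P (t - tau2))).
  assert (hP0 : forall u v, - tau2 <= u <= v -> 0 <= P v - P u).
  { intros u v huv; rewrite <- (Rmult_0_l (v - u)).
    apply (increment_ge _ (fun t => (z t)^2)); [lra | |]; intros t ht;
      [apply hP; lra | apply pow2_ge_0]. }
  assert (hPS : forall tau, 0 < tau <= tau2 -> P 0 - P (0 - tau) <= S^2 * tau).
  { intros tau h; replace tau with (0 - (0 - tau)) at 2 by ring.
    apply (increment_le _ (fun t => (z t)^2)); [lra | |]; intros t ht; [apply hP; lra |].
    rewrite hzy, hphi by lra; apply Rabs_le_sq, hS; lra. }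
  assert (p0 := Rabs_pos a0); assert (p1 := Rabs_pos a1); assert (p2 := Rabs_pos a2).
  assert (hV0 : V 0 <= S^2 * (1 + Rabs a1 * tau1 + Rabs a2 * tau2)).
  { assert (q1 := hPS tau1 ltac:(lra)); assert (q2 := hPS tau2 ltac:(lra)).
    assert (q0 : (z 0)^2 <= S^2) by (rewrite hzy, hphi by lra; apply Rabs_le_sq, hS; lra).
    apply (Rmult_le_compat_l (Rabs a1)) in q1; [| exact p1].
    apply (Rmult_le_compat_l (Rabs a2)) in q2; [| exact p2].
    unfold V; lra. }
  assert (hVz : (z T)^2 <= V T).
  { assert (q1 := hP0 (T - tau1) T ltac:(lra)); assert (q2 := hP0 (T - tau2) T ltac:(lra)).
    unfold V; nra. }
  assert (hmono : - (V 0 * exp (- (2 * A) * 0)) <= - (V T * exp (- (2 * A) * T))).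
  { apply (derive_nonneg_le_open (fun t => - (V t * exp (- (2 * A) * t)))
      (fun t => (2 * A * V t - (2 * z t * dz t + Rabs a1 * ((z t)^2 - (z (t - tau1))^2)
         + Rabs a2 * ((z t)^2 - (z (t - tau2))^2))) * exp (- (2 * A) * t))); [exact hT | | |].
    - intros t ht; unfold V; auto_derive; [known_ex_derive | known_derive].
      unfold Rminus; ring.
    - intros t ht.
      assert (hPc : forall u, - tau2 <= u -> continuity_pt P u)
        by (intros u hu; eapply is_derive_continuity_pt, hP; lra).
      assert (hPd : forall tau, 0 < tau <= tau2 -> continuity_pt (fun u => P (u - tau)) t).
      { intros tau h; apply (continuity_pt_comp (fun u => u - tau) P); [| apply hPc; lra].
        apply derivable_continuous_pt; reg. }
      assert (hzc : continuity_pt z t) by apply continuity_pt_filterlim, hz.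
      apply continuity_pt_opp, continuity_pt_mult.
      + apply continuity_pt_plus; [apply continuity_pt_plus |].
        * apply (continuity_pt_comp z (fun v => v^2)); [exact hzc |].
          apply derivable_continuous_pt; reg.
        * apply continuity_pt_mult; [apply continuity_pt_const; intros ? ?; auto |].
          apply continuity_pt_minus; [apply hPc | apply hPd]; lra.
        * apply continuity_pt_mult; [apply continuity_pt_const; intros ? ?; auto |].
          apply continuity_pt_minus; [apply hPc | apply hPd]; lra.
      + apply derivable_continuous_pt; reg.
    - intros t ht; apply Rmult_le_pos; [| left; apply exp_pos].
      assert (q1 := hP0 (t - tau1) t ltac:(lra)); assert (q2 := hP0 (t - tau2) t ltac:(lra)).
      assert (hVt : (z t)^2 <= V t) by (unfold V; nra).
      assert (hA : 0 <= A) by (unfold A; lra).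
      enough (2 * z t * dz t + Rabs a1 * ((z t)^2 - (z (t - tau1))^2)
         + Rabs a2 * ((z t)^2 - (z (t - tau2))^2) <= 2 * A * (z t)^2) by nra.
      (* Applied to the delayed products, this produces delayed squares that cancel against those
         from the two integrals in [V], leaving [2 A z^2]. *)
      assert (hyoung : forall a p q, - (2 * a * p * q) <= Rabs a * (p^2 + q^2)).
      { intros a p q; unfold Rabs; destruct (Rcase_abs a);
          [assert (0 <= (p - q)^2) by apply pow2_ge_0 | assert (0 <= (p + q)^2) by apply pow2_ge_0];
          nra. }
      assert (y0 := hyoung a0 (z t) (z t)); assert (y1 := hyoung a1 (z t) (z (t - tau1)));
        assert (y2 := hyoung a2 (z t) (z (t - tau2))).
      unfold dz, A; lra. }
  rewrite <- hzy by lra.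
  rewrite Rmult_0_r, exp_0, Rmult_1_r in hmono.
  assert (hE : exp (- (2 * A) * T) * exp (2 * A * T) = 1).
  { rewrite <- exp_plus, <- exp_0; f_equal; ring. }
  assert (hEp := exp_pos (2 * A * T)).
  apply Rle_trans with (V T); [exact hVz |].
  apply Rle_trans with (V 0 * exp (2 * A * T)); [| apply Rmult_le_compat_r; lra].
  replace (V T) with (V T * exp (- (2 * A) * T) * exp (2 * A * T))
    by (rewrite Rmult_assoc, hE; ring).
  apply Rmult_le_compat_r; lra.
Qed.

Lemma exp_le_compat (u v : R) : u <= v -> exp u <= exp v.
Proof.
  intros [h | ->]; [left; now apply exp_increasing | right; reflexivity].
Qed.

Lemma exp_le_compat_Rabs (s u b : R) : 0 <= u <= b -> exp (s * u) <= exp (Rabs s * b).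
Proof.
  intros hu; apply exp_le_compat; assert (h := Rle_abs s); assert (h0 := Rabs_pos s); nra.
Qed.

Lemma dde_growth (a0 a1 a2 tau1 tau2 s0 : R) :
  0 < tau1 < tau2 ->
  triple_root_coeffs a0 a1 a2 tau1 tau2 s0 ->
  exists K, 0 <= K /\
  forall (phi y : R -> R) (S : R),
    dde_solution a0 a1 a2 tau1 tau2 phi y ->
    (forall t, - tau2 <= t <= 0 -> Rabs (phi t) <= S) ->
    forall t, 0 <= t -> Rabs (y t) <= K * S * (1 + t)^2 * exp (s0 * t).
Proof.
  intros htau [e0 [e1 e2]].
  destruct (quadratic_growth tau1 tau2 htau) as [K [hK hgrowth]].
  set (A := Rabs a0 + Rabs a1 + Rabs a2).
  (* On [[0, 2 * tau2]], [Y * S] bounds [y] by the energy estimate, [E] bounds [e^(-s0 u)], and [L]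
     absorbs the coefficients of the equation when bounding [dx]. *)
  set (Y := sqrt ((1 + Rabs a1 * tau1 + Rabs a2 * tau2) * exp (2 * A * (2 * tau2)))).
  set (E := exp (Rabs (- s0) * (2 * tau2))).
  set (L := 1 + Rabs (a0 + s0) + Rabs a1 + Rabs a2).
  assert (p0 := Rabs_pos a0); assert (p1 := Rabs_pos a1); assert (p2 := Rabs_pos a2).
  assert (ps := Rabs_pos (a0 + s0)).
  assert (hL : 1 <= L) by (unfold L; lra).
  assert (hY : 0 <= Y) by apply sqrt_pos.
  assert (hE : 0 < E) by apply exp_pos.
  exists ((K + 1) * (E * Y * L)); split.
  { apply Rmult_le_pos; [lra | repeat apply Rmult_le_pos; lra]. }
  intros phi y S hsol hS t ht.
  assert (hS0 : 0 <= S).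
  { eapply Rle_trans; [apply Rabs_pos | apply (hS 0); lra]. }
  assert (hy : forall u, 0 <= u <= 2 * tau2 -> Rabs (y u) <= Y * S).
  { intros u hu; apply sq_le_Rabs; [now apply Rmult_le_pos |].
    assert (q : 0 <= 1 + Rabs a1 * tau1 + Rabs a2 * tau2) by nra.
    unfold Y; rewrite Rpow_mult_distr, pow2_sqrt;
      [| apply Rmult_le_pos; [exact q | left; apply exp_pos]].
    eapply Rle_trans; [apply (solution_a_priori a0 a1 a2 tau1 tau2 phi y S); auto; lra |].
    rewrite Rmult_assoc, (Rmult_comm (S^2)).
    apply Rmult_le_compat_r; [apply pow2_ge_0 |].
    apply Rmult_le_compat_l; [exact q |].
    apply exp_le_compat; fold A; unfold A; nra. }
  destruct hsol as [hc [hphi heq]].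
  set (x := fun u => exp (- s0 * u) * y u).
  set (dx := fun u => exp (- s0 * u) *
    (- (a0 + s0) * y u - a1 * y (u - tau1) - a2 * y (u - tau2))).
  assert (hyc : forall u, - tau2 < u -> continuity_pt y u).
  { intros u hu; apply continuity_pt_filterlim.
    apply (continuous_ext_loc _ (fun v => y (Rmax (- tau2) v)));
      [now apply clamp_eq_near | now apply continuous_clamp]. }
  assert (hyd : forall tau, 0 < tau <= tau2 -> forall u, 0 < u ->
    continuity_pt (fun v => y (v - tau)) u).
  { intros tau h u hu; apply (continuity_pt_comp (fun v => v - tau) y); [| apply hyc; lra].
    apply derivable_continuous_pt; reg. }
  assert (hx : normalized_solution tau1 tau2 x dx).
  { split; [| split].
    - intros u hu; destruct (heq u hu) as [h1 h2]; unfold x, dx.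
      auto_derive; [auto |].
      assert (h3 : Derive y u = - (a0 * y u + a1 * y (u - tau1) + a2 * y (u - tau2))) by lra.
      replace (Derive (fun v => y v) u) with (Derive y u) by reflexivity.
      rewrite h3; ring.
    - intros u hu; apply continuity_pt_filterlim; unfold dx.
      apply continuity_pt_mult; [apply derivable_continuous_pt; reg |].
      repeat apply continuity_pt_minus; apply continuity_pt_mult;
        try (apply continuity_pt_const; intros ? ?; reflexivity);
        [apply hyc | apply hyd | apply hyd]; lra.
    - intros u hu; unfold x, dx.
      set (beta := tau1 * tau2 * (tau2 - tau1)) in *.
      assert (h : forall tau, exp (- s0 * u) = exp (- s0 * tau) * exp (- s0 * (u - tau)))
        by (intros tau; rewrite <- exp_plus; f_equal; ring).
      transitivity (- (beta * (s0 + a0)) * (exp (- s0 * u) * y u)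
        - (beta * a1) * (exp (- s0 * u) * y (u - tau1))
        - (beta * a2) * (exp (- s0 * u) * y (u - tau2))); [ring |].
      rewrite (h tau1) at 2; rewrite (h tau2) at 2.
      transitivity (- (beta * (s0 + a0)) * (exp (- s0 * u) * y u)
        - (beta * (a1 * exp (- s0 * tau1))) * (exp (- s0 * (u - tau1)) * y (u - tau1))
        - (beta * (a2 * exp (- s0 * tau2))) * (exp (- s0 * (u - tau2)) * y (u - tau2))); [ring |].
      rewrite e0, e1, e2; ring. }
  assert (hEu : forall u, 0 <= u <= 2 * tau2 -> 0 < exp (- s0 * u) <= E).
  { intros u hu; split; [apply exp_pos | now apply exp_le_compat_Rabs]. }
  assert (hxb : forall u, 0 <= u <= 2 * tau2 -> Rabs (x u) <= E * (Y * S)).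
  { intros u hu; unfold x; destruct (hEu u hu) as [h1 h2].
    rewrite Rabs_mult, (Rabs_pos_eq (exp _)) by lra.
    apply Rmult_le_compat; auto using Rabs_pos; lra. }
  assert (hYS : 0 <= E * (Y * S)) by (repeat apply Rmult_le_pos; lra).
  set (M := E * (Y * S) * L).
  assert (hM : E * (Y * S) <= M) by (unfold M; nra).
  assert (hbound : forall u, tau2 <= u <= 2 * tau2 -> Rabs (x u) <= M /\ Rabs (dx u) <= M).
  { intros u hu; split; [eapply Rle_trans; [apply hxb; lra | exact hM] |].
    destruct (hEu u ltac:(lra)) as [h1 h2].
    unfold dx, M; rewrite Rabs_mult, (Rabs_pos_eq (exp _)) by lra.
    rewrite Rmult_assoc; apply Rmult_le_compat; auto using Rabs_pos; [lra |].
    assert (k0 := hy u ltac:(lra)); assert (k1 := hy (u - tau1) ltac:(lra));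
      assert (k2 := hy (u - tau2) ltac:(lra)).
    eapply Rle_trans; [apply Rabs_triang |]; rewrite Rabs_Ropp.
    eapply Rle_trans; [apply Rplus_le_compat_r, Rabs_triang |]; rewrite Rabs_Ropp.
    rewrite !Rabs_mult, Rabs_Ropp.
    apply (Rmult_le_compat_l (Rabs (a0 + s0))) in k0; [| exact ps].
    apply (Rmult_le_compat_l (Rabs a1)) in k1; [| exact p1].
    apply (Rmult_le_compat_l (Rabs a2)) in k2; [| exact p2].
    assert (0 <= Y * S) by now apply Rmult_le_pos.
    unfold L; lra. }
  (* [K] serves for [t >= 2 * tau2], and the extra [1] for the initial interval. *)
  assert (hxt : Rabs (x t) <= (K + 1) * M * (1 + t)^2).
  { assert (h1 : 1 <= (1 + t)^2) by nra.
    assert (hKM : 0 <= K * M) by (apply Rmult_le_pos; lra).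
    destruct (Rle_lt_dec (2 * tau2) t) as [h | h].
    - assert (hg := hgrowth x dx M hx hbound t h); nra.
    - assert (hb := hxb t ltac:(lra)); nra. }
  assert (hyx : y t = exp (s0 * t) * x t).
  { unfold x; rewrite <- Rmult_assoc, <- exp_plus.
    replace (s0 * t + - s0 * t) with 0 by ring; rewrite exp_0; ring. }
  assert (hep := exp_pos (s0 * t)).
  rewrite hyx, Rabs_mult, (Rabs_pos_eq (exp _)), Rmult_comm by lra.
  apply Rmult_le_compat_r; [lra |].
  eapply Rle_trans; [exact hxt |]; unfold M; right; ring.
Qed.

(** * Roots and stability *)

Lemma exp_ge_linear (u : R) :
  0 < u -> exists m, 0 < m /\ forall t, 0 <= t -> m * (1 + t) <= exp (u * t).
Proof.
  intros hu; exists (Rmin 1 u); split; [apply Rmin_glb_lt; lra |].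
  intros t ht; assert (h1 := Rmin_l 1 u); assert (h2 := Rmin_r 1 u).
  apply Rle_trans with (1 + u * t); [nra | apply exp_ineq1_le].
Qed.

Lemma exp_mode_solution (a0 a1 a2 tau1 tau2 sigma omega p q : R) :
  char_fun a0 a1 a2 tau1 tau2 (sigma, omega) = RtoC 0 ->
  let y := fun t => exp (sigma * t) * (p * cos (omega * t) + q * sin (omega * t)) in
  dde_solution a0 a1 a2 tau1 tau2 y y.
Proof.
  intros hroot y.
  assert (hre := char_fun_Re a0 a1 a2 tau1 tau2 sigma omega).
  assert (him := char_fun_Im a0 a1 a2 tau1 tau2 sigma omega).
  rewrite hroot in hre, him; simpl in hre, him.
  set (dy := fun t => exp (sigma * t) * ((sigma * p + omega * q) * cos (omega * t)
    + (sigma * q - omega * p) * sin (omega * t))).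
  assert (hd : forall t, is_derive y t (dy t)).
  { intros t; unfold y, dy; auto_derive; [auto | ring]. }
  split; [| split].
  - intros t _ P hP.
    assert (hc : continuous y t) by (apply (ex_derive_continuous y); now exists (dy t)).
    change (locally t (fun u => - tau2 <= u -> P (y u))).
    exact (filter_imp (F := locally t) (fun u => P (y u)) _ (fun u h _ => h) (hc P hP)).
  - auto.
  - intros t _; split; [now exists (dy t) |].
    rewrite (is_derive_unique _ _ _ (hd t)); unfold y, dy.
    assert (h : forall tau, exp (sigma * (t - tau)) = exp (sigma * t) * exp (- sigma * tau))
      by (intros tau; rewrite <- exp_plus; f_equal; ring).
    rewrite !h, !Rmult_minus_distr_l, !cos_minus, !sin_minus.
    set (r := sigma + a0 + a1 * exp (- sigma * tau1) * cos (omega * tau1)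
      + a2 * exp (- sigma * tau2) * cos (omega * tau2)) in hre.
    set (i := omega - a1 * exp (- sigma * tau1) * sin (omega * tau1)
      - a2 * exp (- sigma * tau2) * sin (omega * tau2)) in him.
    (* This is the real part of [(p - i q) Delta(s) e^(s t)], with [r] and [i] the real and
       imaginary parts of [Delta(s)]. *)
    transitivity (exp (sigma * t) * (r * (p * cos (omega * t) + q * sin (omega * t))
      + i * (q * cos (omega * t) - p * sin (omega * t)))).
    + unfold r, i; ring.
    + rewrite <- hre, <- him; ring.
Qed.

Lemma exp_mode_history_bound (sigma tau t c : R) :
  - tau <= t <= 0 -> -1 <= c <= 1 -> Rabs (exp (sigma * t) * c) <= exp (Rabs sigma * tau).
Proof.
  intros ht hc; rewrite Rabs_mult, (Rabs_pos_eq (exp _)) by (left; apply exp_pos).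
  rewrite <- (Rmult_1_r (exp (Rabs sigma * tau))).
  apply Rmult_le_compat; auto using Rabs_pos; [left; apply exp_pos | |].
  - replace (sigma * t) with (- sigma * - t) by ring.
    rewrite <- (Rabs_Ropp sigma); apply exp_le_compat_Rabs; lra.
  - apply Rabs_le; lra.
Qed.

(** As [|cos| + |sin| >= 1], the growth bounds for the cosine and sine modes add up to
    [e^(sigma t) <= 2 K S (1 + t)^2 e^(s0 t)], impossible for large [t] when [sigma > s0]. *)
Lemma root_Re_le (a0 a1 a2 tau1 tau2 s0 sigma omega : R) :
  0 < tau1 < tau2 ->
  triple_root_coeffs a0 a1 a2 tau1 tau2 s0 ->
  char_fun a0 a1 a2 tau1 tau2 (sigma, omega) = RtoC 0 ->
  sigma <= s0.
Proof.
  intros htau hcoef hroot.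
  destruct (Rle_lt_dec sigma s0) as [h | hlt]; [exact h | exfalso].
  destruct (dde_growth a0 a1 a2 tau1 tau2 s0 htau hcoef) as [K [hK hgrowth]].
  set (S := exp (Rabs sigma * tau2)).
  assert (hS : 0 < S) by apply exp_pos.
  assert (hcos := exp_mode_solution _ _ _ _ _ _ _ 1 0 hroot).
  assert (hsin := exp_mode_solution _ _ _ _ _ _ _ 0 1 hroot).
  assert (bc := hgrowth _ _ S hcos).
  assert (bs := hgrowth _ _ S hsin).
  simpl in bc, bs.
  assert (hbc := bc ltac:(intros t ht; apply exp_mode_history_bound;
    [exact ht | assert (h := COS_bound (omega * t)); lra])).
  assert (hbs := bs ltac:(intros t ht; apply exp_mode_history_bound;
    [exact ht | assert (h := SIN_bound (omega * t)); lra])).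
  (* A third of the exponent: the cube of the linear lower bound outgrows [(1 + t)^2]. *)
  destruct (exp_ge_linear ((sigma - s0) / 3) ltac:(lra)) as [m [hm hexp]].
  assert (hm3 : 0 < m^3) by now apply pow_lt.
  assert (hmain : forall t, 0 <= t -> m^3 * (1 + t) <= 2 * K * S).
  { intros t ht; specialize (hbc t ht); specialize (hbs t ht); specialize (hexp t ht).
    set (c := cos (omega * t)) in *; set (s := sin (omega * t)) in *.
    assert (hcs : s * s + c * c = 1) by apply (sin2_cos2 (omega * t)).
    assert (hcb := COS_bound (omega * t)); assert (hsb := SIN_bound (omega * t)).
    fold c in hcb; fold s in hsb.
    replace (1 * c + 0 * s) with c in hbc by ring.
    replace (0 * c + 1 * s) with s in hbs by ring.
    rewrite Rabs_mult, (Rabs_pos_eq (exp _)) in hbc, hbs by (left; apply exp_pos).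
    assert (hsum : 1 <= Rabs c + Rabs s)
      by (unfold Rabs; destruct (Rcase_abs c), (Rcase_abs s); nra).
    set (g := exp ((sigma - s0) / 3 * t)) in *.
    assert (hg : exp (sigma * t) = g^3 * exp (s0 * t)).
    { unfold g; simpl; rewrite Rmult_1_r, <- !exp_plus; f_equal; field. }
    assert (h0 := exp_pos (s0 * t)); assert (h1 := exp_pos (sigma * t)).
    assert (hb : g^3 <= 2 * K * S * (1 + t)^2).
    { apply (Rmult_le_reg_r (exp (s0 * t))); [exact h0 |]; rewrite <- hg; nra. }
    assert (hg3 : (m * (1 + t))^3 <= g^3) by (apply pow_incr; nra).
    apply (Rmult_le_reg_r ((1 + t)^2)); [apply pow_lt; lra |].
    rewrite Rpow_mult_distr in hg3; simpl in *; lra. }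
  assert (hKS : 0 <= 2 * K * S) by nra.
  (* At this time [hmain] reads [m^3 + 2 K S <= 2 K S]. *)
  assert (ht : 0 <= 2 * K * S / m^3)
    by (apply Rmult_le_pos; [exact hKS | left; now apply Rinv_0_lt_compat]).
  specialize (hmain _ ht).
  rewrite Rmult_plus_distr_l in hmain.
  replace (m^3 * (2 * K * S / m^3)) with (2 * K * S) in hmain by (field; lra).
  lra.
Qed.

Theorem theorem7 :
  forall (a0 a1 a2 tau1 tau2 s0 : R),
    0 < tau1 < tau2 ->
    root_of_multiplicity 3 (char_fun a0 a1 a2 tau1 tau2) (RtoC s0) ->
    strictly_dominant_root (char_fun a0 a1 a2 tau1 tau2) s0 /\
    (s0 < 0 -> exponentially_stable a0 a1 a2 tau1 tau2).
Proof.
  intros a0 a1 a2 tau1 tau2 s0 htau hmult.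
  assert (hcoef := triple_root_coeffs_of_multiplicity _ _ _ _ _ _ htau hmult).
  split; [split |].
  - destruct hmult as [D [hD0 [_ [hroot _]]]].
    rewrite <- hD0; apply hroot; auto with arith.
  - intros [sigma omega] hroot; simpl.
    destruct (root_Re_le _ _ _ _ _ _ _ _ htau hcoef hroot) as [hlt | heq]; [now right | left].
    subst sigma; unfold RtoC; f_equal.
    exact (no_other_root_on_line _ _ _ _ _ _ _ htau hcoef hroot).
  - intros hs0.
    destruct (dde_growth a0 a1 a2 tau1 tau2 s0 htau hcoef) as [K [hK hgrowth]].
    (* Half of the decay [e^(s0 t)] is kept as the rate; the other half absorbs [(1 + t)^2], as the
       square of an exponential with exponent [- s0 / 4]. *)
    destruct (exp_ge_linear (- s0 / 4) ltac:(lra)) as [m [hm hexp]].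
    assert (hm2 : 0 < m^2) by now apply pow_lt.
    assert (hKm : 0 <= K / m^2)
      by (apply Rmult_le_pos; [exact hK | left; now apply Rinv_0_lt_compat]).
    (* Adding [1] makes the constant positive even if [K = 0]. *)
    exists (K / m^2 + 1), (- s0 / 2); split; [lra | split; [lra |]].
    intros phi y _ hsol t ht.
    destruct (solution_bounded_on_history a0 a1 a2 tau1 tau2 phi y ltac:(lra) hsol) as [M hM].
    assert (hS := le_sup_abs phi (- tau2) 0 M hM).
    set (S := sup_abs (- tau2) 0 phi) in *.
    assert (hS0 : 0 <= S) by (eapply Rle_trans; [apply Rabs_pos | apply (hS 0); lra]).
    eapply Rle_trans; [apply (hgrowth phi y S hsol hS t ht) |].
    specialize (hexp t ht).
    assert (hsq : m^2 * (1 + t)^2 <= exp (- s0 / 2 * t)).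
    { replace (exp (- s0 / 2 * t)) with ((exp (- s0 / 4 * t))^2)
        by (simpl; rewrite Rmult_1_r, <- exp_plus; f_equal; field).
      rewrite <- Rpow_mult_distr; apply pow_incr; nra. }
    assert (hsplit : exp (- (- s0 / 2) * t) = exp (s0 * t) * exp (- s0 / 2 * t))
      by (rewrite <- exp_plus; f_equal; field).
    rewrite hsplit.
    assert (he := exp_pos (s0 * t)); assert (he2 := exp_pos (- s0 / 2 * t)).
    apply Rle_trans with (K / m^2 * (exp (s0 * t) * exp (- s0 / 2 * t)) * S).
    + replace (K * S * (1 + t)^2 * exp (s0 * t))
        with (K / m^2 * S * exp (s0 * t) * (m^2 * (1 + t)^2)) by (field; lra).
      replace (K / m^2 * (exp (s0 * t) * exp (- s0 / 2 * t)) * S)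
        with (K / m^2 * S * exp (s0 * t) * exp (- s0 / 2 * t)) by ring.
      apply Rmult_le_compat_l; [| exact hsq].
      apply Rmult_le_pos; [apply Rmult_le_pos |]; lra.
    + apply Rmult_le_compat_r; [exact hS0 |].
      apply Rmult_le_compat_r; [| lra]. apply Rmult_le_pos; lra.
Qed.
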